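(* Let $G=(V,E)$ be a connected graph that is decomposed by sets $A,B$ and a separating clique $C$ with $A\cup B\cup C=V$; that is, $A,B,C$ are nonempty and pairwise disjoint, $C$ is a clique of $G$, and $C$ separates $A$ from $B$ in $G$. Then $$\operatorname{eMLD}(G)=\operatorname{eMLD}(G[A\cup C])\cdot\operatorname{eMLD}(G[B\cup C]).$$
   Context: All graphs are finite, simple and undirected; $G[S]$ is the subgraph induced on $S$. For a $d\times d$ symmetric matrix $\Gamma$ (real or complex) with zero diagonal put $$\operatorname{CM}(\Gamma)=\begin{pmatrix}-\tfrac12\Gamma&\mathbf{1}\\ \mathbf{1}^\top&0\end{pmatrix},$$ and, when this is invertible, let $\theta(\Gamma)$ be the upper-left $d\times d$ block of $\operatorname{CM}(\Gamma)^{-1}$ (for strictly conditionally negative definite $\Gamma$, i.e. $v^\top\Gamma v<0$ for all real $v\neq \mathbf{0}$ with $v\perp\mathbf{1}$, this is the corresponding signed Laplacian, or Hüsler--Reiss precision matrix). A partially-specified conditionally negative definite variogram with respect to $G=(V,E)$ is a symmetric partial matrix $\mathring\Gamma$ with zero diagonal and real entries $\mathring\Gamma_{ij}$ specified exactly for $(i,j)\in E$, all of whose principal submatrices indexed by cliques of $G$ are conditionally negative definite. The matrix completion problem for $G$ and $\mathring\Gamma$ asks for a symmetric matrix $\Gamma$ with zero diagonal and $\Theta=\theta(\Gamma)$ satisfying $$\Gamma_{ij}=\mathring\Gamma_{ij}\ \ \forall (i,j)\in E,\qquad \Theta_{ij}=0\ \ \forall (i,j)\notin E,\ i\neq j .$$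 The extremal (surrogate) maximum likelihood degree $\operatorname{eMLD}(G)$ is the number of complex solutions $\Gamma$ of these equations (dropping the requirement of conditional negative definiteness) for generic $\mathring\Gamma$, i.e. for $\mathring\Gamma$ outside a proper algebraic subset of the space of edge values. *)

(* Defs.v *)
From HB Require Import structures.
From mathcomp Require Import all_boot all_order all_algebra.
From mathcomp Require Import boolp classical_sets functions cardinality reals.
From mathcomp Require Import complex.
From mathcomp Require Import mpoly.

Set Implicit Arguments.
Unset Strict Implicit.
Unset Printing Implicit Defensive.

Import GRing.Theory.
Local Open Scope ring_scope.

Record sgraph := SGraph {
  vert :> finType;
  adj : rel vert;
  adj_sym : ssrbool.symmetric adj;
  adj_irrefl : irreflexive adj }.

Section Graphs.
Variable G : sgraph.

Definition edges : {set {set G}} :=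
  [set [set p.1; p.2]%SET | p : G * G & adj p.1 p.2]%SET.

Definition connected_graph : Prop := forall x y : G, connect (@adj G) x y.

Definition clique (C : {set G}) : Prop :=
  {in C &, forall x y, x != y -> adj x y}.

Definition separates (C A B : {set G}) : Prop :=
  forall x p, x \in A -> path (@adj G) x p -> last x p \in B ->
  exists2 z, z \in x :: p & z \in C.

Definition clique_decomposition (A B C : {set G}) : Prop :=
  [/\ [/\ A != finset.set0, B != finset.set0 & C != finset.set0],
      [/\ [disjoint A & B], [disjoint A & C] & [disjoint B & C]],
      (A :|: B :|: C)%SET = [set: G]%SET, clique C & separates C A B].

End Graphs.

Section Induced.
Variables (G : sgraph) (S : {set G}).
Definition induced_adj : rel {x : G | x \in S} :=
  fun x y => adj (val x) (val y).
Fact induced_sym : ssrbool.symmetric induced_adj.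
Proof. by move=> x y; apply: adj_sym. Qed.
Fact induced_irrefl : irreflexive induced_adj.
Proof. by move=> x; apply: adj_irrefl. Qed.
Definition induced : sgraph := SGraph induced_sym induced_irrefl.
End Induced.

Section CayleyMenger.
Variables (F : fieldType) (d : nat).
Implicit Type Gam : 'M[F]_d.

Definition CM Gam : 'M[F]_(d + 1) :=
  block_mx (- 2%:R^-1 *: Gam) (const_mx 1) (const_mx 1) 0.

(* Meaningful only when [CM Gam \in unitmx]. *)
Definition theta Gam : 'M[F]_d := ulsubmx (invmx (CM Gam)).
End CayleyMenger.

Local Open Scope classical_set_scope.

Section MLDegree.
Variables (R : realType) (G : sgraph).

(* Partial matrices are vectors of edge values: coordinate [k] is the common
   value of the (i, j) and (j, i) entries, where {i, j} is the [k]-th edge.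
   Rows and columns of matrices follow the enumeration of the vertices. *)
Definition edge_values := 'I_#|edges G| -> R.

Definition completions (w : edge_values) : set 'M[R[i]]_#|G| :=
  [set Gam | [/\ Gam^T = Gam, forall i, Gam i i = 0, CM Gam \in unitmx,
     forall k i j, enum_val k = [set enum_val i; enum_val j]%SET ->
       Gam i j = (w k)%:C%C
   & forall i j, i != j -> ~~ adj (enum_val i : G) (enum_val j) ->
       theta Gam i j = 0]].

Definition algebraic_subset (Z : set edge_values) : Prop :=
  exists P : set {mpoly R[#|edges G|]},
    Z = [set w | forall p, P p -> p.@[w] = 0].

Definition generic_completion_number (k : nat) : Prop :=
  exists Z : set edge_values, [/\ algebraic_subset Z, Z != setT
    & forall w, ~ Z w -> (completions w #= `I_k)%card].

(* At most one [k] qualifies, since two proper algebraic subsets of a real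
   affine space do not cover it; the value would be 0 if there were none. *)
Definition eMLD : nat := xget 0%N [set k | generic_completion_number k].
End MLDegree.

(* Main.v *)
From mathcomp Require Import boolp classical_sets functions cardinality reals.
From mathcomp Require Import all_boot all_order all_algebra.
From mathcomp Require Import closed_field complex mpoly ring.
Require Import Defs.

(** Fix edge values w, write w_S for the part on the edges inside S, and call
    completion set of w the set of complex solutions of the equations.

    Linear algebra.  Write D for the clique C together with the bordering index
    of the Cayley-Menger matrix M of a completion.  The block M_DD depends only
    on w, because all pairs in C are edges; suppose that it has an inverse L.
    No edge joins A to B, so the inverse K of M has K_AB = 0, and eliminating
    the blocks with index D shows M_AB = M_AD L M_DB: a completion is determined
    by its restrictions to A u C and B u C.  These restrictions are again
    completions, since the A-rows of the inverse do not change
    ([inverse_on_restrict]).  Conversely two completions on A u C and B u C,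
    with inverses K1 and K2, agree on C, and filling the blocks between A and B
    by the same formula gives a matrix whose inverse is K1 + K2 - L, each term
    extended by zero ([inverse_on_glue]).  Hence the completion set of w is in
    bijection with the product of those of w_(A u C) and w_(B u C)
    ([solutions_product]).  The determinant of M_DD is a polynomial in w; at the
    point where all edge values are 1 it does not vanish, so this holds for
    generic w ([completions_product]).

    If both subgraphs have a generic number of completions, then so has G, and
    the numbers multiply: two proper algebraic subsets do not cover the space.

    The degree is 0 by convention when there is no generic number, so it remains
    to see that a positive generic number k for G forces the existence of generic
    numbers for the two subgraphs.  From the bijection, the completion set of
    w_(A u C) has at most k elements for generic w, but its cardinality might a
    priori vary with the values on the edges of C, compensated by the other
    factor.  It cannot: having at least j completions is a first-order property
    of w over the algebraically closed field R[i], by quantifier elimination it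
    is a Boolean combination of polynomial equations, and therefore it either
    holds for generic w or fails for generic w
    ([definable_generically_decided]).  The largest j for which it holds
    generically is the generic number ([bounded_generic_completion_number]). *)

Set Implicit Arguments.
Unset Strict Implicit.
Unset Printing Implicit Defensive.

Import Num.Theory GRing.Theory.
Local Open Scope ring_scope.

(** * Generic properties of real parameters *)

Section Generic.
Variable R : realType.

(** The witness is a single polynomial: a proper algebraic subset is contained
    in the zero set of one polynomial that does not vanish identically, and
    principal open sets are easier to intersect and to pull back.  The
    nonvanishing is asked of the polynomial function, not of the formal
    polynomial. *)
Definition generically n (Q : ('I_n -> R) -> Prop) : Prop :=
  exists p : {mpoly R[n]},
    (exists w, p.@[w] != 0) /\ forall w, p.@[w] != 0 -> Q w.

Definition generically_decided n (Q : ('I_n -> R) -> Prop) : Prop :=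
  generically Q \/ generically (fun w => ~ Q w).

Lemma generically_true n (Q : ('I_n -> R) -> Prop) :
  (forall w, Q w) -> generically Q.
Proof.
move=> Qall; exists 1; split; last by move=> w _; apply: Qall.
by exists (fun=> 0); rewrite meval1 oner_neq0.
Qed.

Lemma generically_exists n (Q : ('I_n -> R) -> Prop) :
  generically Q -> exists w, Q w.
Proof. by case=> p [[w pw] Qp]; exists w; apply: Qp. Qed.

Lemma generically_sub n (P Q : ('I_n -> R) -> Prop) :
  (forall w, P w -> Q w) -> generically P -> generically Q.
Proof. by move=> PQ [p [np Pp]]; exists p; split=> // w /Pp /PQ. Qed.

(** Two nonempty principal open sets meet because both meet the line through a
    point of each, and there the question is about polynomials in one variable. *)
Lemma mpoly_along_line n (p : {mpoly R[n]}) (u v : 'I_n -> R) :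
  exists q : {poly R}, forall t, q.[t] = p.@[fun i => u i + t * (v i - u i)].
Proof.
pose h i : {poly R} := (u i)%:P + (v i - u i) *: 'X.
exists (mmap polyC h p) => t.
rewrite mevalE /mmap horner_sum; apply: eq_bigr => m _.
rewrite hornerM hornerC; congr (_ * _).
rewrite /mmap1 horner_prod; apply: eq_bigr => i _.
by rewrite horner_exp /h hornerD hornerC hornerZ hornerX mulrC.
Qed.

Lemma exists_nonroot (q : {poly R}) : q != 0 -> exists t, q.[t] != 0.
Proof.
move=> q0; pose rs := [seq i%:R : R | i <- iota 0 (size q)].
have urs : uniq rs.
  by rewrite map_inj_uniq ?iota_uniq // => i j /eqP; rewrite eqr_nat => /eqP.
have /allPn[t _ nt] : ~~ all (root q) rs.
  apply/negP => ars; have := max_poly_roots q0 ars urs.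
  by rewrite size_map size_iota ltnn.
by exists t.
Qed.

Lemma generically_and n (P Q : ('I_n -> R) -> Prop) :
  generically P -> generically Q -> generically (fun w => P w /\ Q w).
Proof.
case=> p [[u pu] Pp] [q [[v qv] Qq]]; exists (p * q); split; last first.
  by move=> w; rewrite mevalM mulf_eq0 negb_or => /andP[/Pp ? /Qq].
have [f fE] := mpoly_along_line p u v; have [g gE] := mpoly_along_line q u v.
have f0 : f != 0.
  apply: contra_neq pu => f0; rewrite -[RHS](horner0 0) -f0 fE.
  by apply: meval_eq => i; rewrite mul0r addr0.
have g0 : g != 0.
  apply: contra_neq qv => g0; rewrite -[RHS](horner0 1) -g0 gE.
  by apply: meval_eq => i; rewrite mul1r subrKC.
have [t] := exists_nonroot (mulf_neq0 f0 g0).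
by rewrite hornerM fE gE -mevalM; exists (fun i => u i + t * (v i - u i)).
Qed.

(** Injectivity lets every point of the smaller parameter space be extended to
    a point of the larger one, so the pulled back polynomial is not
    identically zero. *)
Lemma generically_pullback m n (f : 'I_m -> 'I_n) (Q : ('I_m -> R) -> Prop) :
  injective f -> generically Q -> generically (fun w => Q (w \o f)).
Proof.
move=> f_inj [p [[u pu] Qp]]; exists (p \mPo [tuple 'X_(f i) | i < m]).
have pE w : (p \mPo [tuple 'X_(f i) | i < m]).@[w] = p.@[w \o f].
  rewrite comp_mpoly_meval; apply: meval_eq => i.
  by rewrite tnth_mktuple mevalXU.
split; last by move=> w; rewrite pE => /Qp.
(* Extend u by zero outside the image of f. *)
exists (fun j => if [pick i | f i == j] is Some i then u i else 0).
rewrite pE (_ : _.@[_] = p.@[u]) //; apply: meval_eq => i /=.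
case: pickP => [j /eqP/f_inj-> //|/(_ i)]; by rewrite eqxx.
Qed.

Lemma generically_decided_and n (P Q : ('I_n -> R) -> Prop) :
  generically_decided P -> generically_decided Q ->
  generically_decided (fun w => P w /\ Q w).
Proof.
case=> gP; last by right; apply: generically_sub gP => w nP [].
case=> gQ; last by right; apply: generically_sub gQ => w nQ [].
by left; apply: generically_and.
Qed.

Lemma generically_decided_not n (P : ('I_n -> R) -> Prop) :
  generically_decided P -> generically_decided (fun w => ~ P w).
Proof.
case=> gP; [right|by left]; by apply: generically_sub gP => w Pw; apply.
Qed.

Lemma generically_decided_iff n (P Q : ('I_n -> R) -> Prop) :
  (forall w, P w <-> Q w) -> generically_decided P -> generically_decided Q.
Proof.
move=> PQ [] gP; [left|right]; apply: generically_sub gP => w.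
  by move/PQ.
by apply: contra_not => /PQ.
Qed.

End Generic.

(** * First-order definable predicates *)

Section Constructible.
Variable F : fieldType.

(** The free variables of the formula are the elements of V in the order of
    their enumeration, so that blocks of variables can be indexed by structured
    finite types instead of by offsets into a list. *)
Definition definable (V : finType) (P : (V -> F) -> Prop) : Prop :=
  exists f : GRing.formula F, forall e, GRing.holds (codom e) f <-> P e.

Definition term_function (V : finType) (h : (V -> F) -> F) : Prop :=
  exists t : GRing.term F, forall e, GRing.eval (codom e) t = h e.

Lemma nth_codom_rank (V : finType) (e : V -> F) v :
  (codom e)`_(enum_rank v) = e v.
Proof.
by rewrite (nth_map v) ?nth_enum_rank // -cardE ltn_ord.
Qed.

Section Closure.
Variable V : finType.
Implicit Types (h : (V -> F) -> F) (P Q : (V -> F) -> Prop).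

Lemma term_function_var v : term_function (fun e : V -> F => e v).
Proof. by exists ('X_(enum_rank v))%T => e /=; rewrite nth_codom_rank. Qed.

Lemma term_function_const c : term_function (fun _ : V -> F => c).
Proof. by exists (c%:T)%T. Qed.

Lemma term_functionM h1 h2 : term_function h1 -> term_function h2 ->
  term_function (fun e => h1 e * h2 e).
Proof. by case=> t1 E1 [t2 E2]; exists (t1 * t2)%T => e /=; rewrite E1 E2. Qed.

Lemma term_function_sum (I : Type) (r : seq I) (h : I -> (V -> F) -> F) :
  (forall i, term_function (h i)) ->
  term_function (fun e => \sum_(i <- r) h i e).
Proof.
move=> th; elim: r => [|i r [t E]].
  by exists 0%T => e; rewrite big_nil.
by have [u Eu] := th i; exists (u + t)%T => e /=; rewrite big_cons E Eu.
Qed.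

Lemma definable_iff P Q : (forall e, P e <-> Q e) -> definable P -> definable Q.
Proof. by move=> PQ [f fP]; exists f => e; rewrite fP. Qed.

Lemma definable_eq h1 h2 : term_function h1 -> term_function h2 ->
  definable (fun e => h1 e = h2 e).
Proof. by case=> t1 E1 [t2 E2]; exists (t1 == t2)%T => e /=; rewrite E1 E2. Qed.

Lemma definable_and P Q : definable P -> definable Q ->
  definable (fun e => P e /\ Q e).
Proof.
by case=> f fP [g gQ]; exists (f /\ g)%T => e /=; rewrite fP gQ.
Qed.

Lemma definable_not P : definable P -> definable (fun e => ~ P e).
Proof. by case=> f fP; exists (~ f)%T => e /=; rewrite fP. Qed.

(** Here the hypothesis does not depend on the variables: it carries the
    incidence conditions of the graph, such as two vertices being non-adjacent. *)
Lemma definable_imp (b : Prop) P : definable P -> definable (fun e => b -> P e).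
Proof.
move=> dP; have [hb|nb] := pselect b.
  by apply: definable_iff dP => e; split=> // /(_ hb).
by exists GRing.True => e /=; split.
Qed.

Lemma definable_all (I : finType) (P : I -> (V -> F) -> Prop) :
  (forall i, definable (P i)) -> definable (fun e => forall i, P i e).
Proof.
move=> dP; suff [f fP] : exists f, forall e,
    GRing.holds (codom e) f <-> forall i, i \in enum I -> P i e.
  exists f => e; rewrite fP; split=> Pe i; last by move=> _.
  by apply: Pe; rewrite mem_enum.
elim: (enum I) => [|i r [f fP]]; first by exists GRing.True.
have [g gP] := dP i; exists (g /\ f)%T => e /=; rewrite gP fP.
split=> [[Pi Pr] j|Pr].
  by rewrite inE => /predU1P[->|/Pr].
by split=> [|j jr]; apply: Pr; rewrite inE ?eqxx ?jr ?orbT.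
Qed.

End Closure.

Lemma holds_exists_block (f : GRing.formula F) m (e : seq F) :
  GRing.holds e (foldr GRing.Exists f (iota (size e) m)) <->
  exists s, size s = m /\ GRing.holds (e ++ s) f.
Proof.
elim: m e => [|m IHm] e /=.
  split=> [He|[s [/size0nil-> ]]]; last by rewrite cats0.
  by exists [::]; rewrite cats0.
have rE x : set_nth 0 e (size e) x = rcons e x.
  elim: e {IHm} => [//|y e IHe] /=; by rewrite IHe.
split=> [[x]|[[|x s] [//= [ss] He]]].
  rewrite rE -(size_rcons e x) => /IHm[s [ss He]].
  by exists (x :: s); rewrite /= ss -cat_rcons.
exists x; rewrite rE -(size_rcons e x); apply/IHm.
by exists s; rewrite cat_rcons.
Qed.

Definition join_env (V U : Type) (e : V -> F) (g : U -> F) (x : V + U) : F :=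
  match x with inl v => e v | inr u => g u end.

(** The enumeration of a sum type lists the left summand first, so the
    variables in U are the last ones and form a block that
    [holds_exists_block] can quantify. *)
Lemma codom_join_env (V U : finType) (e : V -> F) (g : U -> F) :
  codom (join_env e g) = codom e ++ codom g.
Proof.
rewrite !codomE !enumT [X in map _ X](_ : _ = sum_enum V U) ?map_cat -?map_comp //.
by rewrite unlock.
Qed.

Lemma definable_exists (V U : finType) (P : (V + U -> F) -> Prop) :
  definable P -> definable (fun e : V -> F => exists g : U -> F, P (join_env e g)).
Proof.
case=> f fP; exists (foldr GRing.Exists f (iota #|V| #|U|)) => e.
rewrite -{1}(size_codom e) holds_exists_block; split=> [[s [ss He]]|[g Pg]].
  exists (fun u => s`_(enum_rank u)); apply/fP; rewrite codom_join_env.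
  rewrite (_ : codom (fun u : U => s`_(enum_rank u)) = s) //.
  apply: (@eq_from_nth _ 0); rewrite size_codom ?ss // => i iU.
  have <- : enum_rank (enum_val (Ordinal iU)) = i :> nat by rewrite enum_valK.
  by rewrite nth_codom_rank.
by exists (codom g); rewrite size_codom -codom_join_env; split=> //; apply/fP.
Qed.

End Constructible.

(** * Definable predicates are generically true or generically false *)

Section GenericTruth.
Variables (R : realType) (n : nat).
Local Notation F := R[i].
Local Notation env w := (codom (fun k : 'I_n => (w k)%:C%C : F)).

(** The constants of the formula are complex, but genericity is about real
    polynomials in real parameters: each term is split into its real and
    imaginary part. *)
Lemma rterm_real_imaginary (t : GRing.term F) : GRing.rterm t ->
  exists p q : {mpoly R[n]}, forall w,
    GRing.eval (env w) t = Complex p.@[w] q.@[w].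
Proof.
elim: t => //=.
- move=> k _; have [kn|nk] := ltnP k n.
    exists 'X_(Ordinal kn), 0 => w; rewrite mevalXU meval0.
    have kE : k = enum_rank (Ordinal kn) by rewrite enum_rank_ord.
    by rewrite [X in nth _ _ X]kE nth_codom_rank.
  exists 0, 0 => w; rewrite meval0 nth_default //.
  by rewrite size_codom card_ord.
- by move=> [a b] _; exists a%:MP, b%:MP => w; rewrite !mevalC.
- by move=> k _; exists (k%:R), 0 => w;
    rewrite meval0 rmorph_nat -(rmorph_nat (real_complex R)).
- move=> t1 IH1 t2 IH2 /andP[/IH1[p1 [q1 E1]] /IH2[p2 [q2 E2]]].
  by exists (p1 + p2), (q1 + q2) => w; rewrite E1 E2 !mevalD.
- by move=> t IH /IH[p [q E]]; exists (- p), (- q) => w; rewrite E !mevalN.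
- move=> t IH k /IH[p [q E]]; exists (p *+ k), (q *+ k) => w.
  rewrite E !mevalMn; elim: k => [//|k IHk]; by rewrite !mulrSr IHk.
- move=> t1 IH1 t2 IH2 /andP[/IH1[p1 [q1 E1]] /IH2[p2 [q2 E2]]].
  exists (p1 * p2 - q1 * q2), (p1 * q2 + q1 * p2) => w.
  by rewrite E1 E2 mevalB mevalD !mevalM.
move=> t IH k /IH[p [q E]]; elim: k => [|k [p' [q' E']]].
  by exists 1, 0 => w; rewrite expr0 meval1 meval0.
exists (p * p' - q * q'), (p * q' + q * p') => w.
by rewrite exprS E' E mevalB mevalD !mevalM.
Qed.

(** An equation between polynomial functions either holds everywhere or fails
    outside the zero set of a polynomial that is not identically zero, and both
    alternatives survive Boolean combinations. *)
Lemma qf_generically_decided (f : GRing.formula F) :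
  GRing.qf_form f -> GRing.rformula f ->
  generically_decided (fun w => GRing.holds (env w) f).
Proof.
elim: f => //=.
- by move=> b _ _; case: b; [left|right]; apply: generically_true.
- move=> t1 t2 _ /andP[/rterm_real_imaginary[p1 [q1 E1]]].
  move=> /rterm_real_imaginary[p2 [q2 E2]].
  have eqE w : GRing.eval (env w) t1 = GRing.eval (env w) t2 <->
      (p1 - p2).@[w] = 0 /\ (q1 - q2).@[w] = 0.
    rewrite E1 E2 !mevalB; split=> [[-> ->]|[/subr0_eq-> /subr0_eq->]] //.
    by rewrite !subrr.
  have [[w [p0|q0]]|all0] := pselect
    (exists w, (p1 - p2).@[w] != 0 \/ (q1 - q2).@[w] != 0).
  + right; exists (p1 - p2); split; first by exists w.
    by move=> u /eqP pu /eqE[].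
  + right; exists (q1 - q2); split; first by exists w.
    by move=> u /eqP pu /eqE[].
  left; apply: generically_true => w; apply/eqE.
  by split; apply: contra_notP all0 => /eqP; exists w; [left|right].
- move=> f IHf g IHg /andP[/IHf{}IHf /IHg{}IHg] /andP[/IHf{}IHf /IHg{}IHg].
  exact: generically_decided_and.
- move=> f IHf g IHg /andP[/IHf{}IHf /IHg{}IHg] /andP[/IHf{}IHf /IHg{}IHg].
  apply: generically_decided_iff (generically_decided_not (generically_decided_and
    (generically_decided_not IHf) (generically_decided_not IHg))) => w.
  by rewrite not_andE !not_notE.
- move=> f IHf g IHg /andP[/IHf{}IHf /IHg{}IHg] /andP[/IHf{}IHf /IHg{}IHg].
  apply: generically_decided_iff (generically_decided_not (generically_decided_and
    IHf (generically_decided_not IHg))) => w.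
  by rewrite not_andE not_notE implyE.
by move=> f IHf /IHf{}IHf /IHf; apply: generically_decided_not.
Qed.

Lemma definable_generically_decided (P : ('I_n -> F) -> Prop) :
  definable P -> generically_decided (fun w : 'I_n -> R => P (fun k => (w k)%:C%C)).
Proof.
case=> f fP.
(* Inverses of terms are removed first; then quantifiers are eliminated. *)
have closedF := @solve_monicpoly F.
have wf := @ClosedFieldQE.wf_ex_elim F.
have ok := @ClosedFieldQE.holds_ex_elim F closedF.
pose g := GRing.quantifier_elim (@ClosedFieldQE.ex_elim F) (GRing.to_rform f).
have /andP[qg rg] : GRing.qf_form g && GRing.rformula g.
  by apply: GRing.quantifier_elim_wf wf _ _; apply: GRing.to_rform_rformula.
apply: generically_decided_iff (qf_generically_decided qg rg) => w.
rewrite -fP.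
have qeP := GRing.quantifier_elim_rformP wf ok (env w) (GRing.to_rform_rformula f).
split=> [/(GRing.qf_evalP _ qg)/qeP/GRing.to_rformP //|/GRing.to_rformP/qeP gw].
by apply/(GRing.qf_evalP _ qg).
Qed.
End GenericTruth.

(** * Lower bounds on cardinalities *)

Section AtLeast.
Local Open Scope classical_set_scope.
Local Open Scope card_scope.

Definition at_least T (j : nat) (X : set T) : Prop :=
  exists g : 'I_j -> T, injective g /\ forall s, X (g s).

Lemma at_leastP T j (X : set T) : at_least j X <-> `I_j #<= X.
Proof.
rewrite (card_le_eql card_II); split=> [[g [g_inj Xg]]|].
  have gT : g @` classical_sets.setT #= (classical_sets.setT : set 'I_j).
    by apply: inj_card_eq => s s' _ _; apply: g_inj.
  by rewrite -(card_le_eql gT); apply: subset_card_le => _ [s _ <-].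
move=> /card_leP/injfunPex[g _ g_inj].
exists (fun s => val (g (SigSub (mem_set (I : classical_sets.setT s))))).
split=> [s s' /val_inj/g_inj|s]; last exact: set_valP.
by move=> /(_ (mem_set I) (mem_set I))/(congr1 val).
Qed.

Lemma at_least_leq T j m (X : set T) : X #= `I_m -> at_least j X -> (j <= m)%N.
Proof. by move=> Xm /at_leastP; rewrite (card_le_eqr Xm) card_le_II. Qed.

Lemma card_eq_at_least T m (X : set T) :
  at_least m X -> ~ at_least m.+1 X -> X #= `I_m.
Proof.
move=> /at_leastP mX /at_leastP mSX.
have [[n Xn]|/infiniteP Xinf] := pselect (finite_set X); last first.
  case: mSX; apply: card_le_trans Xinf; exact: card_leT.
rewrite !(card_le_eqr Xn) !card_le_II in mX mSX.
suff <- : n = m by [].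
by apply/eqP; rewrite eqn_leq mX andbT leqNgt; apply/negP.
Qed.

End AtLeast.

(** * Having at least j completions is definable *)

Section Definability.
Variables (R : realType) (G : sgraph) (j : nat).
Local Notation F := R[i].
Local Notation d := #|G|.
Local Notation V := 'I_#|edges G|.
Local Notation U := ('I_j * ('I_d * 'I_d + 'I_(d + 1) * 'I_(d + 1)))%type.

(** The unknowns of the j-th fold system are, for each of j solutions, the
    entries of the matrix and those of the inverse of its Cayley-Menger matrix;
    the latter make invertibility and the conditions on theta polynomial. *)
Definition variogram_of (e : V + U -> F) (s : 'I_j) : 'M[F]_d :=
  \matrix_(i, i') e (inr (s, inl (i, i'))).

Definition inverse_of (e : V + U -> F) (s : 'I_j) : 'M[F]_(d + 1) :=
  \matrix_(a, b) e (inr (s, inr (a, b))).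

Definition completion_equations (e : V + U -> F) (s : 'I_j) : Prop :=
  let Gam := variogram_of e s in let K := inverse_of e s in
  (forall i i', Gam i i' = Gam i' i) /\
  (forall i, Gam i i = 0) /\
  (forall a b, \sum_c CM Gam a c * K c b = (a == b)%:R) /\
  (forall k i i', enum_val k = [set enum_val i; enum_val i']%SET ->
     Gam i i' = e (inl k)) /\
  (forall i i', i != i' -> ~~ adj (enum_val i : G) (enum_val i') ->
     K (lshift 1 i) (lshift 1 i') = 0).

Definition distinct_completions (e : V + U -> F) : Prop :=
  (forall s s', s != s' ->
     ~ forall i i', variogram_of e s i i' = variogram_of e s' i i') /\
  forall s, completion_equations e s.

Lemma term_function_ext (W : finType) (h1 h2 : (W -> F) -> F) :
  h1 =1 h2 -> term_function h1 -> term_function h2.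
Proof. by move=> E [t tE]; exists t => e; rewrite tE E. Qed.

Lemma term_function_variogram s i i' :
  term_function (fun e : V + U -> F => variogram_of e s i i').
Proof.
apply: term_function_ext (term_function_var _ (inr (s, inl (i, i')))) => e.
by rewrite mxE.
Qed.

Lemma term_function_inverse s a b :
  term_function (fun e : V + U -> F => inverse_of e s a b).
Proof.
apply: term_function_ext (term_function_var _ (inr (s, inr (a, b)))) => e.
by rewrite mxE.
Qed.

Lemma term_function_CM s a b :
  term_function (fun e : V + U -> F => CM (variogram_of e s) a b).
Proof.
rewrite /CM; case: (split_ordP a) => a' ->; case: (split_ordP b) => b' ->.
- apply: term_function_ext (term_functionM (term_function_const _ (- 2^-1))
    (term_function_variogram s a' b')) => e.
  by rewrite block_mxEul [RHS]mxE.
- by apply: term_function_ext (term_function_const _ 1) => e;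
    rewrite block_mxEur mxE.
- by apply: term_function_ext (term_function_const _ 1) => e;
    rewrite block_mxEdl mxE.
- by apply: term_function_ext (term_function_const _ 0) => e;
    rewrite block_mxEdr mxE.
Qed.

Lemma definable_distinct_completions : definable distinct_completions.
Proof.
have tG := term_function_variogram; have tK := term_function_inverse.
apply: definable_and; [do 2 apply: definable_all => ?|apply: definable_all => s].
  apply/definable_imp/definable_not; do 2 apply: definable_all => ?.
  by apply: definable_eq; apply: tG.
apply: definable_and.
  by do 2 apply: definable_all => ?; apply: definable_eq; apply: tG.
apply: definable_and.
  by apply: definable_all => ?; apply: definable_eq;
    [apply: tG|apply: term_function_const].
apply: definable_and.
  do 2 apply: definable_all => ?; apply: definable_eq.
    apply: term_function_sum => c; apply: term_functionM.
      exact: term_function_CM.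
    exact: tK.
  exact: term_function_const.
apply: definable_and.
  do 3 apply: definable_all => ?; apply/definable_imp/definable_eq; first exact: tG.
  exact: term_function_var.
do 2 apply: definable_all => ?; do 2 apply: definable_imp.
apply: definable_eq; first exact: tK.
exact: term_function_const.
Qed.

(** The inverse matrix is determined by the completion, so quantifying over it
    too does not change the number of solutions. *)
Lemma at_least_completionsE (w : edge_values R G) :
  (exists g : U -> F, distinct_completions (join_env (fun k => (w k)%:C%C) g)) <->
  at_least j (completions w).
Proof.
split=> [[g [dist eqs]]|[X [X_inj cX]]].
  set e := join_env _ g in dist eqs; exists (variogram_of e); split=> [s s' E|s].
    by apply/eqP/negP => /negP/dist; apply=> i i'; rewrite E.
  have [sym [diag [inv [val0 zero]]]] := eqs s.
  have KE : CM (variogram_of e s) *m inverse_of e s = 1%:M.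
    by apply/matrixP => a b; rewrite [in LHS]mxE [RHS]mxE; apply: inv.
  have [unitCM _] := mulmx1_unit KE.
  split=> //; first by apply/matrixP => i i'; rewrite mxE.
  move=> i i' ii' na; rewrite -[RHS](zero i i' ii' na) /theta.
  by rewrite -[invmx _]mulmx1 -KE mulmxA mulVmx // mul1mx !mxE.
exists (fun u => match u with
  | (s, inl ii) => X s ii.1 ii.2
  | (s, inr ab) => invmx (CM (X s)) ab.1 ab.2 end).
set e := join_env _ _.
have GE s : variogram_of e s = X s by apply/matrixP => i i'; rewrite mxE.
have KE s : inverse_of e s = invmx (CM (X s)).
  by apply/matrixP => i i'; rewrite mxE.
split=> [s s' ss' E|s].
  by move/eqP: ss'; apply; apply: X_inj; rewrite -!GE; apply/matrixP.
have [sym diag unitCM val0 zero] := cX s.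
rewrite /completion_equations GE KE; split; [|split; [|split; [|split]]] => //.
- by move=> i i'; rewrite -{1}sym mxE.
- move=> a b; have := mulmxV unitCM => /matrixP/(_ a b).
  by rewrite [in LHS]mxE [RHS]mxE.
by move=> i i' ii' na; rewrite -[RHS](zero i i' ii' na) !mxE.
Qed.

Lemma at_least_completions_decided :
  generically_decided (fun w : edge_values R G => at_least j (completions w)).
Proof.
have := definable_generically_decided (definable_exists definable_distinct_completions).
by apply: generically_decided_iff => w; apply: at_least_completionsE.
Qed.

End Definability.

(** * Generic completion numbers *)

Section GenericNumber.
Variable R : realType.
Local Open Scope classical_set_scope.
Local Open Scope card_scope.

Lemma generic_completion_numberP (G : sgraph) k :
  generic_completion_number R G k <->
  generically (fun w : edge_values R G => completions w #= `I_k).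
Proof.
split=> [[Z [[P ->] PT Pk]]|[p [[w pw] pk]]].
  have [w nPw] : exists w : edge_values R G, ~ forall p, P p -> p.@[w] = 0.
    apply/existsNP => all0; case/eqP: PT; apply/seteqP; split=> // w _.
    exact: all0.
  have [p /not_implyP[Pp /eqP pw]] := (existsNP _).2 nPw.
  exists p; split; first by exists w.
  by move=> u /eqP pu; apply: Pk => /(_ p Pp).
exists [set w | forall q, [set p] q -> q.@[w] = 0]; split.
- by exists [set p].
- apply/eqP => E; move/eqP: pw; apply.
  by have : classical_sets.setT w by []; rewrite -E => /(_ p erefl).
by move=> u nu; apply: pk; apply/eqP => pu; apply: nu => q ->.
Qed.

Lemma generic_completion_number_uniq (G : sgraph) k l :
  generic_completion_number R G k -> generic_completion_number R G l -> k = l.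
Proof.
move=> /generic_completion_numberP gk /generic_completion_numberP gl.
have [w [wk wl]] := generically_exists (generically_and gk gl).
by apply/card_eq_II; rewrite -(card_eql wk).
Qed.

Lemma eMLD_eq (G : sgraph) k : generic_completion_number R G k -> eMLD R G = k.
Proof.
move=> gk; rewrite /eMLD; case: xgetP => [l _ /= gl|/(_ k)//].
exact: generic_completion_number_uniq gl gk.
Qed.

Lemma eMLD_neq0 (G : sgraph) :
  eMLD R G <> 0%N -> generic_completion_number R G (eMLD R G).
Proof. by rewrite /eMLD; case: xgetP. Qed.

(** The properties of having at least j completions are generically true or
    generically false; the generic number is the last j before they turn
    false. *)
Lemma bounded_generic_completion_number (G : sgraph) k :
  ~ generically (fun w : edge_values R G => at_least k (completions w)) ->
  exists m, generic_completion_number R G m.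
Proof.
elim: k => [|k IHk] nk.
  case: nk; apply: generically_true => w.
  by apply/at_leastP; rewrite II0; apply: card_ge0.
have [gk|ngk] := pselect (generically (fun w : edge_values R G =>
  at_least k (completions w))); last exact: IHk.
exists k; apply/generic_completion_numberP.
case: (at_least_completions_decided R G k.+1) => // gn.
apply: generically_sub (generically_and gk gn) => w [].
exact: card_eq_at_least.
Qed.
End GenericNumber.

(** * Inverses of square blocks, restriction and gluing *)

Section InverseOn.
Variables (F : fieldType) (T : finType).
Implicit Types (S A B D U : {set T}) (M K L : T -> T -> F).

(** Functions on pairs of indices restrict to arbitrary subsets without any
    renumbering, whereas products and inverses are available for matrices:
    [block] passes from the former to the latter one pair of subsets at a
    time. *)
Definition block S S' M : 'M[F]_(#|S|, #|S'|) :=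
  \matrix_(i, j) M (enum_val i) (enum_val j).

Definition product_over U M K i j : F := \sum_(k in U) M i k * K k j.

Definition inverse_on S M K : Prop :=
  {in S &, forall i j, product_over S M K i j = (i == j)%:R}.

Lemma block_eqP S S' M K :
  block S S' M = block S S' K <-> {in S & S', M =2 K}.
Proof.
split=> [/matrixP E i j iS jS'|E]; last first.
  by apply/matrixP => i j; rewrite !mxE; apply: E; apply: enum_valP.
have := E (enum_rank_in iS i) (enum_rank_in jS' j).
by rewrite !mxE !enum_rankK_in.
Qed.

Lemma block_product S S' U M K :
  block S S' (product_over U M K) = block S U M *m block U S' K.
Proof.
apply/matrixP => i j; rewrite !mxE /product_over big_enum_val.
by apply: eq_bigr => k _; rewrite !mxE.
Qed.

Lemma block_productU S S' A D M K : [disjoint A & D] ->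
  block S S' (product_over (A :|: D) M K) =
  block S A M *m block A S' K + block S D M *m block D S' K.
Proof.
move=> AD; rewrite -!block_product; apply/matrixP => i j; rewrite !mxE.
by rewrite /product_over (eq_bigl _ _ (fun k => in_setU k A D)) bigU.
Qed.

Lemma block_id S : block S S (fun i j => (i == j)%:R) = 1%:M.
Proof. by apply/matrixP => i j; rewrite !mxE (inj_eq enum_val_inj). Qed.

Lemma block_id_disjoint S S' : [disjoint S & S'] ->
  block S S' (fun i j => (i == j)%:R) = 0.
Proof.
move=> dSS'; apply/matrixP => i j; rewrite !mxE.
case: eqP => // E; move: (enum_valP j); rewrite -E.
by rewrite (disjointFr dSS') // enum_valP.
Qed.

Lemma block_tr S S' M : (forall i j, M i j = M j i) ->
  (block S S' M)^T = block S' S M.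
Proof. by move=> symM; apply/matrixP => i j; rewrite !mxE symM. Qed.

Lemma inverse_on_block U M K S S' : S \subset U -> S' \subset U ->
  inverse_on U M K ->
  block S S' (product_over U M K) = block S S' (fun i j => (i == j)%:R).
Proof.
move=> /subsetP sU /subsetP s'U inv; apply/block_eqP => i j /sU iU /s'U.
exact: inv.
Qed.

Lemma inverse_onE S M K : inverse_on S M K <-> block S S M *m block S S K = 1%:M.
Proof.
rewrite -block_product -block_id; split; first exact: inverse_on_block.
by move/block_eqP.
Qed.

Lemma inverse_on_comm S M K : inverse_on S M K -> inverse_on S K M.
Proof. by move=> /inverse_onE/mulmx1C/inverse_onE. Qed.

Lemma eq_inverse_on S M M' K :
  {in S &, M =2 M'} -> inverse_on S M K -> inverse_on S M' K.
Proof.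
by move=> /block_eqP E /inverse_onE inv; apply/inverse_onE; rewrite -E.
Qed.

Lemma inverse_on_sym S M K : (forall i j, M i j = M j i) -> inverse_on S M K ->
  (block S S K)^T = block S S K.
Proof.
move=> symM /inverse_onE inv.
have invT : (block S S K)^T *m block S S M = 1%:M.
  by rewrite -(block_tr S S symM) -trmx_mul inv trmx1.
by rewrite -[RHS]mul1mx -invT -mulmxA inv mulmx1.
Qed.

Lemma inverse_onU A D M K : [disjoint A & D] ->
  inverse_on (A :|: D) M K <->
  [/\ block A A M *m block A A K + block A D M *m block D A K = 1%:M,
      block A A M *m block A D K + block A D M *m block D D K = 0,
      block D A M *m block A A K + block D D M *m block D A K = 0
    & block D A M *m block A D K + block D D M *m block D D K = 1%:M].
Proof.
move=> AD; have DA : [disjoint D & A] by rewrite disjoint_sym.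
have sA := subsetUl A D; have sD := subsetUr A D.
rewrite -!(block_productU _ _ _ _ AD) -!block_id.
rewrite -(block_id_disjoint AD) -(block_id_disjoint DA).
split=> [inv|[/block_eqP AA /block_eqP Ad /block_eqP dA /block_eqP DD] i j].
  by split; apply: inverse_on_block inv.
by move=> /setUP[iA|iD] /setUP[jA|jD]; [apply: AA|apply: Ad|apply: dA|apply: DD].
Qed.

Section Gluing.
Variables (A B D : {set T}).
Hypotheses (AB : [disjoint A & B]) (AD : [disjoint A & D]) (BD : [disjoint B & D]).

Let ABD : [disjoint A :|: B & D].
Proof. by rewrite -setI_eq0 setIUl setU_eq0 !setI_eq0 AD BD. Qed.

Lemma block_product3 S S' M K :
  block S S' (product_over (A :|: B :|: D) M K) =
  block S A M *m block A S' K + block S B M *m block B S' K +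
  block S D M *m block D S' K.
Proof.
by rewrite (block_productU _ _ _ _ ABD) -block_product (block_productU _ _ _ _ AB).
Qed.

(** This is K1 + K2 - L, with K1, K2 and L extended by zero outside A u D,
    B u D and D. *)
Definition glued_inverse L K1 K2 i j : F :=
  if (i \in A) && (j \in B) || (i \in B) && (j \in A) then 0
  else if (i \in D) && (j \in D) then K1 i j + K2 i j - L i j
  else if (i \in A) || (j \in A) then K1 i j else K2 i j.

(** Verified block by block.  By the formula for M_AB, the terms of the A-rows
    of the product that involve K2 add up to M_AD L times the D-rows of M K2,
    which are those of the identity; the B-rows are symmetric. *)
Lemma inverse_on_glue M L K1 K2 :
  inverse_on D M L -> inverse_on (A :|: D) M K1 -> inverse_on (B :|: D) M K2 ->
  block A B M = block A D M *m block D D L *m block D B M ->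
  block B A M = block B D M *m block D D L *m block D A M ->
  inverse_on (A :|: B :|: D) M (glued_inverse L K1 K2).
Proof.
move=> /inverse_onE DL /(inverse_onU _ _ AD)[A1 A2 A3 A4].
move=> /(inverse_onU _ _ BD)[B1 B2 B3 B4] MAB MBA.
have LD := mulmx1C DL.
set K := glued_inverse L K1 K2.
have fA i : i \in A -> (i \in B = false) * (i \in D = false).
  by move=> iA; rewrite (disjointFr AB iA) (disjointFr AD iA).
have fB i : i \in B -> (i \in A = false) * (i \in D = false).
  by move=> iB; rewrite (disjointFl AB iB) (disjointFr BD iB).
have fD i : i \in D -> (i \in A = false) * (i \in B = false).
  by move=> iD; rewrite (disjointFl AD iD) (disjointFl BD iD).
have KAA : block A A K = block A A K1.
  apply/block_eqP => i j iA jA.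
  by rewrite /K /glued_inverse iA jA ?(fA i iA, fA j jA).
have KAB : block A B K = 0.
  by apply/matrixP => i j; rewrite !mxE /K /glued_inverse !enum_valP.
have KBA : block B A K = 0.
  by apply/matrixP => i j; rewrite !mxE /K /glued_inverse !enum_valP /= orbT.
have KAD : block A D K = block A D K1.
  apply/block_eqP => i j iA jD.
  by rewrite /K /glued_inverse iA ?(fA i iA, fD j jD) ?andbF.
have KDA : block D A K = block D A K1.
  apply/block_eqP => i j iD jA.
  by rewrite /K /glued_inverse jA ?(fD i iD, fA j jA) ?andbF.
have KBB : block B B K = block B B K2.
  apply/block_eqP => i j iB jB.
  by rewrite /K /glued_inverse iB jB ?(fB i iB, fB j jB) ?andbF.
have KBD : block B D K = block B D K2.
  apply/block_eqP => i j iB jD.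
  by rewrite /K /glued_inverse iB ?(fB i iB, fD j jD) ?andbF.
have KDB : block D B K = block D B K2.
  apply/block_eqP => i j iD jB.
  by rewrite /K /glued_inverse jB ?(fD i iD, fB j jB) ?andbF.
have KDD : block D D K = block D D K1 + block D D K2 - block D D L.
  apply/matrixP => i j; rewrite !mxE /K /glued_inverse.
  by rewrite ?(fD _ (enum_valP i), fD _ (enum_valP j)) !enum_valP.
have EAB : block A B M *m block B B K2 + block A D M *m block D B K2 = 0.
  rewrite MAB -[block A D M in X in _ + X]mulmx1 -LD mulmxA -!mulmxA.
  by rewrite -!mulmxDr B3 !mulmx0.
have EBA : block B A M *m block A A K1 + block B D M *m block D A K1 = 0.
  rewrite MBA -[block B D M in X in _ + X]mulmx1 -LD mulmxA -!mulmxA.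
  by rewrite -!mulmxDr A3 !mulmx0.
have EAD : block A B M *m block B D K2 + block A D M *m block D D K2 =
    block A D M *m block D D L.
  rewrite MAB -[block A D M in X in _ + X]mulmx1 -LD mulmxA -!mulmxA.
  by rewrite -!mulmxDr B4 mulmx1.
have EBD : block B A M *m block A D K1 + block B D M *m block D D K1 =
    block B D M *m block D D L.
  rewrite MBA -[block B D M in X in _ + X]mulmx1 -LD mulmxA -!mulmxA.
  by rewrite -!mulmxDr A4 mulmx1.
have disjBA : [disjoint B & A] by rewrite disjoint_sym.
have disjDA : [disjoint D & A] by rewrite disjoint_sym.
have disjDB : [disjoint D & B] by rewrite disjoint_sym.
(* It suffices to check the nine blocks of M K = 1. *)
suff eqs S S' : S \in [:: A; B; D] -> S' \in [:: A; B; D] ->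
    block S S' (product_over (A :|: B :|: D) M K) =
    block S S' (fun i j => (i == j)%:R).
  move=> i j iU jU.
  have [S [SU iS]] : exists S, S \in [:: A; B; D] /\ i \in S.
    by case/setUP: iU => [/setUP[]|] ?; [exists A|exists B|exists D];
       rewrite !inE eqxx ?orbT.
  have [S' [SU' jS]] : exists S, S \in [:: A; B; D] /\ j \in S.
    by case/setUP: jU => [/setUP[]|] ?; [exists A|exists B|exists D];
       rewrite !inE eqxx ?orbT.
  by have /block_eqP := eqs S S' SU SU'; apply.
rewrite !inE => /or3P[] /eqP-> /or3P[] /eqP->;
  rewrite ?block_id ?block_id_disjoint // block_product3
    ?(KAA, KAB, KBA, KAD, KDA, KBB, KBD, KDB, KDD).
- by rewrite mulmx0 addr0.
- by rewrite mulmx0 add0r.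
- by rewrite mulmxBr mulmxDr -[X in _ + _ + X]addrA addrACA
     A2 add0r addrA EAD subrr.
- by rewrite mulmx0 addr0.
- by rewrite mulmx0 add0r.
- by rewrite mulmxBr mulmxDr -[X in _ + _ + X]addrA addrACA
     EBD [X in _ + X]addrA B2 add0r subrr.
- by rewrite mulmx0 addr0.
- by rewrite mulmx0 add0r.
by rewrite mulmxBr mulmxDr DL -[X in _ + _ + X]addrA addrACA
  A4 [X in _ + X]addrA B4 subrr addr0.
Qed.

End Gluing.

(** Only the block on D of the inverse feels the removal of B; its new value
    is the solution X of M_DA K_AD + M_DD X = 1. *)
Definition restricted_inverse A D M K L i j : F :=
  if (i \in D) && (j \in D)
  then L i j - product_over D L (product_over A M K) i j else K i j.

(** Since K_AB = 0, the B-columns of M K = 1 read K_DB = - L M_DB K_BB,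
    then (M_BB - M_BD L M_DB) K_BB = 1 and (M_AB - M_AD L M_DB) K_BB = 0; the
    first makes K_BB invertible, so the second gives the formula for M_AB. *)
Lemma inverse_on_restrict A B D M K L :
  [disjoint A & B] -> [disjoint A & D] -> [disjoint B & D] ->
  {in A & B, forall i j, K i j = 0} -> {in B & A, forall i j, K i j = 0} ->
  inverse_on (A :|: B :|: D) M K -> inverse_on D M L ->
  inverse_on (A :|: D) M (restricted_inverse A D M K L) /\
  block A B M = block A D M *m block D D L *m block D B M.
Proof.
move=> AB AD BD KAB0 KBA0 inv /inverse_onE DL; have LD := mulmx1C DL.
have KAB : block A B K = 0.
  by apply/matrixP => i j; rewrite !mxE KAB0 ?enum_valP.
have KBA : block B A K = 0.
  by apply/matrixP => i j; rewrite !mxE KBA0 ?enum_valP.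
have sA : A \subset A :|: B :|: D by rewrite -setUA subsetUl.
have sB : B \subset A :|: B :|: D by rewrite setUAC subsetUr.
have sD : D \subset A :|: B :|: D by rewrite subsetUr.
have BA : [disjoint B & A] by rewrite disjoint_sym.
have DA : [disjoint D & A] by rewrite disjoint_sym.
have DB : [disjoint D & B] by rewrite disjoint_sym.
have MK S S' := @inverse_on_block (A :|: B :|: D) M K S S'.
have KM S S' sS sS' :=
  @inverse_on_block (A :|: B :|: D) K M S S' sS sS' (inverse_on_comm inv).
have := MK _ _ sA sA inv;
  rewrite block_id block_product3 // KBA mulmx0 addr0 => AA.
have := MK _ _ sD sA inv;
  rewrite block_id_disjoint // block_product3 // KBA mulmx0 addr0 => dA.
have := MK _ _ sA sB inv;
  rewrite block_id_disjoint // block_product3 // KAB mulmx0 add0r => aB.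
have := MK _ _ sB sB inv;
  rewrite block_id block_product3 // KAB mulmx0 add0r => BB.
have := MK _ _ sD sB inv;
  rewrite block_id_disjoint // block_product3 // KAB mulmx0 add0r => dB.
have := KM _ _ sA sD;
  rewrite block_id_disjoint // block_product3 // KAB mul0mx addr0 => Ad.
have KDA : block D A K = - (block D D L *m block D A M *m block A A K).
  apply/eqP; rewrite -addr_eq0 -[block D A K]mul1mx -LD -!mulmxA -mulmxDr.
  by rewrite addrC dA mulmx0.
have KDB : block D B K = - (block D D L *m block D B M *m block B B K).
  apply/eqP; rewrite -addr_eq0 -[block D B K]mul1mx -LD -!mulmxA -mulmxDr.
  by rewrite addrC dB mulmx0.
have KAD : block A D K = - (block A A K *m block A D M *m block D D L).
  apply/eqP; rewrite -addr_eq0 -[block A D K]mulmx1 -DL mulmxA -mulmxDl.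
  by rewrite addrC Ad mul0mx.
split; last first.
  have inv_right :
      (block B B M - block B D M *m block D D L *m block D B M) *m block B B K = 1%:M.
    by rewrite mulmxBl -BB KDB mulmxN !mulmxA.
  have zero :
      (block A B M - block A D M *m block D D L *m block D B M) *m block B B K = 0.
    by rewrite mulmxBl -aB KDB mulmxN !mulmxA.
  (* Cancel the invertible block K_BB on the right. *)
  by apply/subr0_eq; rewrite -[LHS]mulmx1 -(mulmx1C inv_right) mulmxA zero mul0mx.
have inv_left :
    block A A K *m (block A A M - block A D M *m block D D L *m block D A M) = 1%:M.
  by apply: mulmx1C; rewrite mulmxBl -AA KDA mulmxN !mulmxA.
set K1 := restricted_inverse A D M K L.
have K1AA : block A A K1 = block A A K.
  by apply/block_eqP => i j iA jA; rewrite /K1 /restricted_inverse (disjointFr AD iA).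
have K1AD : block A D K1 = block A D K.
  by apply/block_eqP => i j iA jD; rewrite /K1 /restricted_inverse (disjointFr AD iA).
have K1DA : block D A K1 = block D A K.
  apply/block_eqP => i j iD jA.
  by rewrite /K1 /restricted_inverse (disjointFr AD jA) andbF.
have K1DD : block D D K1 = block D D L - block D D L *m (block D A M *m block A D K).
  rewrite -!block_product; apply/matrixP => i j; rewrite !mxE.
  by rewrite /K1 /restricted_inverse !enum_valP.
apply/(inverse_onU _ _ AD); rewrite K1AA K1AD K1DA K1DD; split=> //; last first.
  by rewrite mulmxBr !mulmxA DL mul1mx addrC subrK.
rewrite mulmxBr addrCA !mulmxA -mulmxBl KAD mulmxN !mulmxA.
by rewrite (mulmx1C inv_left) mul1mx subrr.
Qed.

End InverseOn.

(** * Completions along a separating clique *)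

Section Solutions.
Variables (F : fieldType) (G : sgraph).
Implicit Types (S A B C : {set G}) (Gam v : G -> G -> F) (K : option G -> option G -> F).

(** The index None is the bordering row and column of the Cayley-Menger
    matrix. *)
Definition cone S : {set option G} := [set o | if o is Some x then x \in S else true].

Definition CM_fun Gam (a b : option G) : F :=
  match a, b with
  | Some x, Some y => - 2%:R^-1 * Gam x y
  | None, None => 0
  | _, _ => 1
  end.

(** Completions of the subgraph induced on S, kept as functions on all of G
    that vanish outside S: the solution sets for A u C, B u C and G then live in
    the same type and are compared by truncation. *)
Definition solutions S v : set (G -> G -> F) :=
  [set Gam |
    [/\ forall x y, Gam x y = Gam y x, forall x, Gam x x = 0,
        forall x y, ~~ ((x \in S) && (y \in S)) -> Gam x y = 0,
        {in S &, forall x y, adj x y -> Gam x y = v x y}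
      & exists2 K, inverse_on (cone S) (CM_fun Gam) K &
          {in S &, forall x y, x != y -> ~~ adj x y -> K (Some x) (Some y) = 0}]]%classic.

Definition cut S Gam x y : F := if (x \in S) && (y \in S) then Gam x y else 0.

Lemma CM_fun_sym Gam : (forall x y, Gam x y = Gam y x) ->
  forall a b, CM_fun Gam a b = CM_fun Gam b a.
Proof. by move=> symG [x|] [y|] //=; rewrite symG. Qed.

Lemma eq_CM_fun S Gam Gam' : {in S &, Gam =2 Gam'} ->
  {in cone S &, CM_fun Gam =2 CM_fun Gam'}.
Proof. by move=> E [x|] [y|]; rewrite !inE => // xS yS /=; rewrite E. Qed.

Lemma coneU A C : cone (A :|: C) = Some @: A :|: cone C.
Proof.
apply/setP => -[x|]; rewrite !inE ?orbT //; by rewrite (mem_imset _ _ (@Some_inj _)).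
Qed.

Lemma disjoint_Some A B : [disjoint A & B] ->
  [disjoint Some @: A & Some @: B].
Proof.
move=> AB; apply/pred0P => -[x|] /=; last first.
  by apply/negbTE/negP => /andP[/imsetP[]].
rewrite !(mem_imset _ _ (@Some_inj _)); apply/negbTE/negP => /andP[xA].
by rewrite (disjointFr AB xA).
Qed.

Lemma disjoint_Some_cone A C : [disjoint A & C] ->
  [disjoint Some @: A & cone C].
Proof.
move=> AC; apply/pred0P => -[x|] /=; last first.
  by apply/negbTE/negP => /andP[/imsetP[]].
rewrite (mem_imset _ _ (@Some_inj _)) inE; apply/negbTE/negP => /andP[xA].
by rewrite (disjointFr AC xA).
Qed.

Section Decomposition.
Variables A B C : {set G}.
Hypothesis dec : clique_decomposition A B C.

Lemma decomposition_sym : clique_decomposition B A C.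
Proof.
have [[A0 B0 C0] [AB AC BC] cover cC sepC] := dec; split=> //.
- by split=> //; rewrite disjoint_sym.
- by rewrite [B :|: A]setUC.
move=> x p xB px lA.
have [||z] := sepC (last x p) (rev (belast x p)) lA.
- rewrite rev_path; rewrite (eq_path (e' := @adj G)) // => a b.
  exact: adj_sym.
- case: p px lA => [|y p] //= _ _.
  by rewrite rev_cons last_rcons.
move=> zp zC; exists z => //.
by rewrite lastI -mem_rev rev_rcons.
Qed.

(** An edge between A and B would be a path that avoids C. *)
Lemma decomposition_nonadj x y : x \in A -> y \in B -> ~~ adj x y.
Proof.
have [_ [_ AC BC] _ _ sepC] := dec => xA yB; apply/negP => xy.
have [|z] := sepC x [:: y] xA _ yB; first by rewrite /= xy.
rewrite !inE => /orP[] /eqP->.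
  by rewrite (disjointFr AC xA).
by rewrite (disjointFr BC yB).
Qed.

End Decomposition.

Section Restriction.
Variables A B C : {set G}.
Hypothesis dec : clique_decomposition A B C.
Variables (v : G -> G -> F) (L : option G -> option G -> F).
Hypotheses (v_diag : forall x, v x x = 0).
Hypothesis CL : inverse_on (cone C) (CM_fun v) L.

Lemma cone_cover : cone [set: G] = Some @: A :|: Some @: B :|: cone C.
Proof.
have [_ _ cover _ _] := dec.
by rewrite -cover coneU imsetU.
Qed.

(** All entries on a clique are prescribed, so one inverse serves every
    solution. *)
Lemma clique_inverse S Gam : C \subset S -> solutions S v Gam ->
  inverse_on (cone C) (CM_fun Gam) L.
Proof.
have [_ _ _ cC _] := dec => /subsetP CS [symG diagG _ GE _].
apply: eq_inverse_on CL; apply: eq_CM_fun => x y xC yC.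
have [->|xy] := eqVneq x y; first by rewrite v_diag diagG.
by rewrite GE ?CS // cC.
Qed.

Lemma solutions_cut Gam : solutions setT v Gam ->
  solutions (A :|: C) v (cut (A :|: C) Gam) /\
  block (Some @: A) (Some @: B) (CM_fun Gam) =
  block (Some @: A) (cone C) (CM_fun Gam) *m block (cone C) (cone C) L
   *m block (cone C) (Some @: B) (CM_fun Gam).
Proof.
have [_ [AB AC BC] cover cC sepC] := dec => solG.
have [symG diagG _ GE [K inv K0]] := solG.
have nAB := decomposition_nonadj dec.
have KAB : {in Some @: A & Some @: B, forall a b, K a b = 0}.
  move=> _ _ /imsetP[x xA ->] /imsetP[y yB ->]; apply: K0; rewrite ?inE //.
    by apply: contraTneq xA => ->; rewrite (disjointFl AB yB).
  exact: nAB.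
have KBA : {in Some @: B & Some @: A, forall a b, K a b = 0}.
  move=> _ _ /imsetP[x xB ->] /imsetP[y yA ->]; apply: K0; rewrite ?inE //.
    by apply: contraTneq yA => <-; rewrite (disjointFl AB xB).
  by rewrite adj_sym nAB.
rewrite cone_cover in inv.
have [] := inverse_on_restrict (disjoint_Some AB) (disjoint_Some_cone AC)
  (disjoint_Some_cone BC) KAB KBA inv (clique_inverse (subsetT C) solG).
rewrite -coneU => inv1 ->; split=> //.
have cutE : {in A :|: C &, Gam =2 cut (A :|: C) Gam}.
  by move=> x y xS yS; rewrite /cut xS yS.
split.
- by move=> x y; rewrite /cut andbC symG.
- by move=> x; rewrite /cut diagG if_same.
- by move=> x y; rewrite /cut => /negbTE->.
- by move=> x y xS yS xy; rewrite -cutE // GE ?inE.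
exists (restricted_inverse (Some @: A) (cone C) (CM_fun Gam) K L).
  apply: eq_inverse_on inv1; exact: eq_CM_fun.
move=> x y _ _ xy nxy; rewrite /restricted_inverse !inE.
case: ifP => [/andP[xC yC]|_]; first by rewrite cC in nxy.
by apply: K0; rewrite ?inE.
Qed.

End Restriction.

Section Bijection.
Variables A B C : {set G}.
Hypothesis dec : clique_decomposition A B C.
Variables (v : G -> G -> F) (L : option G -> option G -> F).
Hypotheses (v_diag : forall x, v x x = 0).
Hypothesis CL : inverse_on (cone C) (CM_fun v) L.
Hypothesis F2 : (2%:R : F) != 0.

Let decBA := decomposition_sym dec.

(** The factor -2 undoes the factor -1/2 of the Cayley-Menger matrix.  The
    entries between B and A are transposed by hand to keep the matrix
    symmetric. *)
Definition glue Gam1 Gam2 x y : F :=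
  let T x y := - 2%:R *
    product_over (cone C) (CM_fun Gam1) (product_over (cone C) L (CM_fun Gam2))
      (Some x) (Some y) in
  if (x \in A :|: C) && (y \in A :|: C) then Gam1 x y
  else if (x \in B :|: C) && (y \in B :|: C) then Gam2 x y
  else if x \in A then T x y else T y x.

Lemma solutions_glue Gam1 Gam2 :
  solutions (A :|: C) v Gam1 -> solutions (B :|: C) v Gam2 ->
  [/\ solutions setT v (glue Gam1 Gam2), cut (A :|: C) (glue Gam1 Gam2) = Gam1
    & cut (B :|: C) (glue Gam1 Gam2) = Gam2].
Proof.
have [_ [AB AC BC] cover cC sepC] := dec => sol1 sol2.
have [sym1 diag1 zero1 GE1 [K1 inv1 K10]] := sol1.
have [sym2 diag2 zero2 GE2 [K2 inv2 K20]] := sol2.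
have inC1 := clique_inverse dec v_diag CL (subsetUr A C) sol1.
have inC2 := clique_inverse decBA v_diag CL (subsetUr B C) sol2.
have nAB := decomposition_nonadj dec.
have inABC x : [\/ x \in A, x \in B | x \in C].
  have : x \in [set: G] by rewrite inE.
  by rewrite -cover !inE -orbA => /or3P.
have fA x : x \in A -> (x \in B = false) * (x \in C = false).
  by move=> xA; rewrite (disjointFr AB xA) (disjointFr AC xA).
have fB x : x \in B -> (x \in A = false) * (x \in C = false).
  by move=> xB; rewrite (disjointFl AB xB) (disjointFr BC xB).
have fC x : x \in C -> (x \in A = false) * (x \in B = false).
  by move=> xC; rewrite (disjointFl AC xC) (disjointFl BC xC).
have G12C : {in C &, Gam1 =2 Gam2}.
  move=> x y xC yC; have [->|xy] := eqVneq x y; first by rewrite diag1 diag2.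
  by rewrite GE1 ?GE2 ?inE ?xC ?yC ?orbT // cC.
set Gam := glue Gam1 Gam2.
have E1 : {in A :|: C &, Gam =2 Gam1}.
  by move=> x y xS yS; rewrite /Gam /glue xS yS.
have E2 : {in B :|: C &, Gam =2 Gam2}.
  move=> x y xS yS; rewrite /Gam /glue xS yS; case: ifP => // /andP[xS' yS'].
  apply: G12C.
    by move: xS xS'; rewrite !inE => /orP[/fB->|->].
  by move: yS yS'; rewrite !inE => /orP[/fB->|->].
have part x : [\/ [/\ (x \in A) = true, (x \in B) = false & (x \in C) = false],
    [/\ (x \in A) = false, (x \in B) = true & (x \in C) = false]
  | [/\ (x \in A) = false, (x \in B) = false & (x \in C) = true]].
  by case: (inABC x) => xP; [apply: Or31|apply: Or32|apply: Or33];
    [have [] := fA x xP|have [] := fB x xP|have [] := fC x xP].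
have symG x y : Gam x y = Gam y x.
  rewrite /Gam /glue !inE.
  by case: (part x) => -[-> -> ->]; case: (part y) => -[-> -> ->] //=.
have MAB : block (Some @: A) (Some @: B) (CM_fun Gam) =
    block (Some @: A) (cone C) (CM_fun Gam) *m block (cone C) (cone C) L
    *m block (cone C) (Some @: B) (CM_fun Gam).
  have -> : block (Some @: A) (cone C) (CM_fun Gam) =
      block (Some @: A) (cone C) (CM_fun Gam1).
    apply/block_eqP => _ b /imsetP[x xA ->]; case: b => [y|] //=.
    by rewrite inE => yC; rewrite E1 ?inE ?xA ?yC ?orbT.
  have -> : block (cone C) (Some @: B) (CM_fun Gam) =
      block (cone C) (Some @: B) (CM_fun Gam2).
    apply/block_eqP => a _ aC /imsetP[y yB ->]; case: a aC => [x|] //=.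
    by rewrite inE => xC; rewrite E2 ?inE ?yB ?xC ?orbT.
  rewrite -mulmxA -!block_product.
  apply/block_eqP => _ _ /imsetP[x xA ->] /imsetP[y yB ->] /=.
  rewrite /Gam /glue !inE xA yB !(fA x xA, fB y yB) /= mulrA.
  by rewrite mulNr mulrN opprK mulVf // mul1r.
have MBA : block (Some @: B) (Some @: A) (CM_fun Gam) =
    block (Some @: B) (cone C) (CM_fun Gam) *m block (cone C) (cone C) L
    *m block (cone C) (Some @: A) (CM_fun Gam).
  have symM := CM_fun_sym symG.
  rewrite -(block_tr _ _ symM) MAB !trmx_mul !(block_tr _ _ symM) mulmxA.
  by rewrite (inverse_on_sym (CM_fun_sym sym1) inC1).
have inC : inverse_on (cone C) (CM_fun Gam) L.
  apply: eq_inverse_on inC1; apply: eq_CM_fun => x y xC yC.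
  by rewrite E1 // inE ?xC ?yC orbT.
have cut1 : cut (A :|: C) Gam = Gam1.
  apply/funext => x; apply/funext => y; rewrite /cut.
  by case: ifP => [/andP[xS yS]|/negbT nS]; [apply: E1|rewrite zero1].
have cut2 : cut (B :|: C) Gam = Gam2.
  apply/funext => x; apply/funext => y; rewrite /cut.
  by case: ifP => [/andP[xS yS]|/negbT nS]; [apply: E2|rewrite zero2].
split=> //; split=> //.
- by move=> x; rewrite /Gam /glue; case: (part x) => -[xA xB xC];
    rewrite !inE xA xB xC /= ?diag1 ?diag2.
- by move=> x y; rewrite !inE.
- move=> x y _ _; case: (part x) => -[xA xB xC]; case: (part y) => -[yA yB yC] xy.
  + by rewrite E1 ?GE1 // !inE ?xA ?yA.
  + by move: xy; rewrite (negbTE (nAB x y xA yB)).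
  + by rewrite E1 ?GE1 // !inE ?xA ?yC ?orbT.
  + by move: xy; rewrite adj_sym (negbTE (nAB y x yA xB)).
  + by rewrite E2 ?GE2 // !inE ?xB ?yB.
  + by rewrite E2 ?GE2 // !inE ?xB ?yC ?orbT.
  + by rewrite E1 ?GE1 // !inE ?xC ?yA ?orbT.
  + by rewrite E2 ?GE2 // !inE ?xC ?yB ?orbT.
  + by rewrite E1 ?GE1 // !inE ?xC ?yC ?orbT.
exists (glued_inverse (Some @: A) (Some @: B) (cone C) L K1 K2).
  rewrite (cone_cover dec); apply: inverse_on_glue => //.
  - exact: disjoint_Some.
  - exact: disjoint_Some_cone.
  - exact: disjoint_Some_cone.
  - rewrite -coneU; apply: eq_inverse_on inv1; apply: eq_CM_fun => x y xS yS.
    by rewrite E1.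
  - rewrite -coneU; apply: eq_inverse_on inv2; apply: eq_CM_fun => x y xS yS.
    by rewrite E2.
move=> x y _ _ xy nxy.
rewrite /glued_inverse !(mem_imset _ _ (@Some_inj _)) ![_ \in cone C]inE.
case: (part x) => -[xA xB xC]; case: (part y) => -[yA yB yC];
  rewrite xA xB xC yA yB yC //=.
- by rewrite K10 // inE ?xA ?yA.
- by rewrite K10 // inE ?xA ?yC ?orbT.
- by rewrite K20 // inE ?xB ?yB.
- by rewrite K20 // inE ?xB ?yC ?orbT.
- by rewrite K10 // inE ?xC ?yA ?orbT.
- by rewrite K20 // inE ?xC ?yB ?orbT.
by move: nxy; rewrite cC.
Qed.

Lemma solutions_product :
  set_bij (solutions setT v)
    (solutions (A :|: C) v `*` solutions (B :|: C) v)%classic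
    (fun Gam => (cut (A :|: C) Gam, cut (B :|: C) Gam)).
Proof.
have [_ _ cover _ _] := dec.
split.
- move=> Gam sol; split; first exact: (solutions_cut dec v_diag CL sol).1.
  exact: (solutions_cut decBA v_diag CL sol).1.
- move=> Gam Gam' /set_mem sol /set_mem sol' [cutA cutB].
  have [symG _ _ _ _] := sol; have [symG' _ _ _ _] := sol'.
  have E1 : {in A :|: C &, Gam =2 Gam'}.
    move=> x y xS yS; have := congr1 (fun f => f x y) cutA.
    by rewrite /cut xS yS.
  have E2 : {in B :|: C &, Gam =2 Gam'}.
    move=> x y xS yS; have := congr1 (fun f => f x y) cutB.
    by rewrite /cut xS yS.
  have EAB : {in A & B, Gam =2 Gam'}.
    have : block (Some @: A) (Some @: B) (CM_fun Gam) =
        block (Some @: A) (Some @: B) (CM_fun Gam').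
      rewrite (solutions_cut dec v_diag CL sol).2.
      rewrite (solutions_cut dec v_diag CL sol').2.
      congr (_ *m _ *m _); apply/block_eqP.
        move=> _ [y|] /imsetP[x xA ->]; rewrite inE //= => yC.
        by rewrite E1 // inE ?xA ?yC ?orbT.
      move=> [x|] _ + /imsetP[y yB ->]; rewrite inE //= => xC.
      by rewrite E2 // inE ?yB ?xC ?orbT.
    move=> /block_eqP E x y xA yB.
    have := E _ _ (imset_f Some xA) (imset_f Some yB).
    by move=> /mulfI; apply; rewrite oppr_eq0 invr_eq0.
  have inABC x : [\/ x \in A, x \in B | x \in C].
    have : x \in [set: G] by rewrite inE.
    by rewrite -cover !inE -orbA => /or3P.
  apply/funext => x; apply/funext => y.
  case: (inABC x) => xP; case: (inABC y) => yP.
  + by apply: E1; rewrite inE ?xP ?yP ?orbT.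
  + exact: EAB.
  + by apply: E1; rewrite inE ?xP ?yP ?orbT.
  + by rewrite symG symG' EAB.
  + by apply: E2; rewrite inE ?xP ?yP ?orbT.
  + by apply: E2; rewrite inE ?xP ?yP ?orbT.
  + by apply: E1; rewrite inE ?xP ?yP ?orbT.
  + by apply: E2; rewrite inE ?xP ?yP ?orbT.
  + by apply: E1; rewrite inE ?xP ?yP ?orbT.
move=> [Gam1 Gam2] [/= sol1 sol2]; exists (glue Gam1 Gam2).
  by have [] := solutions_glue sol1 sol2.
by have [_ -> ->] := solutions_glue sol1 sol2.
Qed.

End Bijection.
End Solutions.

(** * Cardinalities of products *)

Section Cards.
Local Open Scope card_scope.
Local Open Scope classical_set_scope.

Lemma set_bij_card_eq T U (X : set T) (Y : set U) (f : T -> U) :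
  set_bij X Y f -> X #= Y.
Proof.
by move=> fXY; have [g] : $|{bij X >-> Y}| by [apply/bijPex; exists f]; apply: pcard_eq.
Qed.

(** Quotient and remainder by l identify the integers below k * l with pairs. *)
Lemma card_eq_setX T U (X : set T) (Y : set U) k l :
  X #= `I_k -> Y #= `I_l -> X `*` Y #= `I_(k * l).
Proof.
move=> /card_set_bijP[f [fX f_inj f_surj]] /card_set_bijP[g [gY g_inj g_surj]].
apply: (@set_bij_card_eq _ _ _ _ (fun z => f z.1 * l + g z.2)%N); split.
- move=> [x y] [/= /fX fx /gY gy] /=.
  by apply: (@leq_trans ((f x).+1 * l)); rewrite ?mulSn ?[(l + _)%N]addnC
    ?ltn_add2l // -mulSnr leq_mul2r fx orbT.
- move=> [x y] [x' y'] /set_mem[/= Xx Yy] /set_mem[/= Xx' Yy'] E.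
  have l0 : (0 < l)%N by apply: leq_ltn_trans (gY _ Yy).
  congr (_, _).
    apply: f_inj; rewrite ?inE //; do ?exact: mem_set.
    by have := congr1 (divn^~ l) E; rewrite !divnMDl // !divn_small ?addn0 //; apply: gY.
  apply: g_inj; rewrite ?inE //; do ?exact: mem_set.
  by have := congr1 (modn^~ l) E; rewrite !modnMDl // !modn_small //; apply: gY.
move=> n /= nkl.
have l0 : (0 < l)%N by case: l nkl {gY g_inj g_surj} => //; rewrite muln0.
have nk : (n %/ l < k)%N by rewrite ltn_divLR.
have [x Xx fx] := f_surj _ nk.
have [y Yy gy] := g_surj _ (ltn_pmod n l0).
by exists (x, y) => //=; rewrite fx gy -divn_eq.
Qed.

Lemma at_least_card_eq T U j (X : set T) (Y : set U) :
  X #= Y -> at_least j X -> at_least j Y.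
Proof. by move=> XY /at_leastP jX; apply/at_leastP; rewrite -(card_le_eqr XY). Qed.

End Cards.

(** * Matrices indexed by the image of an injection *)

Section Transport.
Variables (F : fieldType) (T : finType) (n : nat) (e : 'I_n -> T).
Hypothesis e_inj : injective e.

Implicit Type M : 'M[F]_n.

Definition extend_matrix (M : 'M[F]_n) (s t : T) : F :=
  if [pick i | e i == s] is Some i
  then if [pick j | e j == t] is Some j then M i j else 0 else 0.

Lemma pick_inj i : [pick i' | e i' == e i] = Some i.
Proof. by case: pickP => [j /eqP/e_inj->|/(_ i)] //; rewrite eqxx. Qed.

Lemma extend_matrixE M i j : extend_matrix M (e i) (e j) = M i j.
Proof. by rewrite /extend_matrix !pick_inj. Qed.

Lemma extend_matrix0 M s t : ~~ ((s \in codom e) && (t \in codom e)) ->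
  extend_matrix M s t = 0.
Proof.
rewrite /extend_matrix; case: pickP => // i /eqP<-; case: pickP => // j /eqP<-.
by rewrite !codom_f.
Qed.

Lemma inverse_on_image (M K : T -> T -> F) :
  inverse_on [set e i | i in 'I_n] M K <->
  (\matrix_(i, j) M (e i) (e j)) *m (\matrix_(i, j) K (e i) (e j)) = 1%:M.
Proof.
have prodE i j : product_over [set e i | i in 'I_n] M K (e i) (e j) =
    ((\matrix_(i, j) M (e i) (e j)) *m (\matrix_(i, j) K (e i) (e j))) i j.
  rewrite /product_over big_imset /=; last by move=> ? ? _ _; apply: e_inj.
  by rewrite !mxE; apply: eq_bigr => k _; rewrite !mxE.
split=> [inv|/matrixP inv _ _ /imsetP[i _ ->] /imsetP[j _ ->]].
  apply/matrixP => i j; rewrite -prodE inv ?imset_f //.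
  by rewrite !mxE (inj_eq e_inj).
by rewrite prodE inv mxE (inj_eq e_inj).
Qed.

End Transport.

Lemma inverse_on_exists (F : fieldType) (T : finType) (S : {set T}) M :
  block S S M \in unitmx -> exists L : T -> T -> F, inverse_on S M L.
Proof.
move=> uM; exists (extend_matrix (@enum_val _ (mem S)) (invmx (block S S M))).
apply/inverse_onE; rewrite -[RHS](mulmxV uM); congr (_ *m _).
by apply/matrixP => i j; rewrite mxE extend_matrixE //; apply: enum_val_inj.
Qed.

(** * Edge values and graph embeddings *)

Section EdgeFunction.
Variables (R : realType) (G : sgraph).

(** The value 0 off the edges makes the function vanish on the diagonal, as a
    variogram does. *)
Definition edge_function (w : edge_values R G) (x y : G) : R :=
  if [pick k : 'I_#|edges G| | enum_val k == [set x; y]] is Some k then w k else 0.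

Lemma edge_function_edge w k x y :
  enum_val k = [set x; y] -> edge_function w x y = w k.
Proof.
move=> kxy; rewrite /edge_function; case: pickP => [l /eqP|/(_ k)/eqP//].
by rewrite -kxy => /enum_val_inj->.
Qed.

Lemma edgesP (e : {set G}) :
  reflect (exists x y, adj x y /\ e = [set x; y]) (e \in edges G).
Proof.
apply: (iffP imsetP) => [[[x y]]|[x [y [xy ->]]]]; last by exists (x, y); rewrite ?inE.
by rewrite inE => xy ->; exists x, y.
Qed.

Lemma mem_edges (x y : G) : ([set x; y] \in edges G) = adj x y.
Proof.
apply/edgesP/idP => [[a [b [ab E]]]|xy]; last by exists x, y.
have : a \in [set x; y] by rewrite E !inE eqxx.
have : b \in [set x; y] by rewrite E !inE eqxx orbT.
have ab' : a != b by apply: contraTneq ab => ->; rewrite adj_irrefl.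
rewrite !inE => /orP[]/eqP bE /orP[]/eqP aE; move: ab ab'; rewrite aE bE ?eqxx //.
by rewrite adj_sym.
Qed.

Lemma adj_edge (x y : G) : adj x y -> exists k : 'I_#|edges G|, enum_val k = [set x; y].
Proof.
rewrite -mem_edges => xy; exists (enum_rank_in xy [set x; y]).
by rewrite enum_rankK_in.
Qed.

Lemma edge_function_nonadj w x y : ~~ adj x y -> edge_function w x y = 0.
Proof.
rewrite -mem_edges /edge_function; case: pickP => // k /eqP<-.
by rewrite enum_valP.
Qed.

End EdgeFunction.

Section GraphEmbedding.
Variables (R : realType) (H G : sgraph) (f : H -> G).
Hypotheses (f_inj : injective f) (f_adj : forall x y, adj (f x) (f y) = adj x y).

Lemma edge_image (k : 'I_#|edges H|) : f @: enum_val k \in edges G.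
Proof.
have /edgesP[x [y [xy ->]]] := enum_valP k.
by rewrite imsetU1 imset_set1 mem_edges f_adj.
Qed.

Definition edge_embedding (k : 'I_#|edges H|) : 'I_#|edges G| :=
  enum_rank_in (edge_image k) (f @: enum_val k).

Lemma edge_embeddingE k : enum_val (edge_embedding k) = f @: enum_val k.
Proof. by rewrite enum_rankK_in // edge_image. Qed.

Lemma edge_embedding_inj : injective edge_embedding.
Proof.
move=> k l /(congr1 enum_val); rewrite !edge_embeddingE.
by move=> /(imset_inj f_inj)/enum_val_inj.
Qed.

Let vertex_at (i : 'I_#|H|) : G := f (enum_val i).

Let cone_at (a : 'I_(#|H| + 1)) : option G :=
  match split a with inl i => Some (vertex_at i) | inr _ => None end.

Let vertex_at_inj : injective vertex_at.
Proof. by move=> i j /f_inj/enum_val_inj. Qed.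

Let cone_at_inj : injective cone_at.
Proof.
move=> a b; rewrite /cone_at.
case: (split_ordP a) => i ->; case: (split_ordP b) => j -> //.
  by move=> [] /f_inj/enum_val_inj->.
by rewrite !ord1.
Qed.

Let cone_at_lshift i : cone_at (lshift 1 i) = Some (vertex_at i).
Proof. by rewrite /cone_at (unsplitK (inl i)). Qed.

Let cone_at_rshift i : cone_at (rshift #|H| i) = None.
Proof. by rewrite /cone_at (unsplitK (inr i)). Qed.

Let cone_image : cone (f @: setT) = [set cone_at a | a in 'I_(#|H| + 1)].
Proof.
apply/setP => -[x|]; rewrite inE; apply/esym.
  apply/imsetP/imsetP => [[a _]|[y _ ->]].
    rewrite /cone_at; case: split => // i [->]; by exists (enum_val i).
  exists (lshift 1 (enum_rank y)) => //.
  by rewrite cone_at_lshift /vertex_at enum_rankK.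
by apply/imsetP; exists (rshift #|H| ord0); rewrite ?cone_at_rshift.
Qed.

Let matrix_of (Gam : G -> G -> R[i]) : 'M[R[i]]_#|H| :=
  \matrix_(i, j) Gam (vertex_at i) (vertex_at j).

Let CM_matrix_of Gam :
  \matrix_(a, b) CM_fun Gam (cone_at a) (cone_at b) = CM (matrix_of Gam).
Proof.
apply/matrixP => a b; rewrite mxE /CM.
case: (split_ordP a) => i ->; case: (split_ordP b) => j ->;
  rewrite ?cone_at_lshift ?cone_at_rshift /=.
- by rewrite block_mxEul !mxE.
- by rewrite block_mxEur !mxE.
- by rewrite block_mxEdl !mxE.
- by rewrite block_mxEdr !mxE.
Qed.

(** Stated for an embedding f so that it covers both G itself, by the identity,
    and its induced subgraphs, by the inclusion of the vertices. *)
Lemma card_completions (w : edge_values R G) :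
  (completions (w \o edge_embedding) #=
   solutions (f @: setT) (fun x y => (edge_function w x y)%:C%C))%card.
Proof.
have at_rank x : f x = vertex_at (enum_rank x) by rewrite /vertex_at enum_rankK.
have atP i : vertex_at i \in f @: setT by rewrite /vertex_at imset_f.
have at_adj i j : adj (vertex_at i) (vertex_at j) = adj (enum_val i : H) (enum_val j).
  exact: f_adj.
apply/card_esym/(@set_bij_card_eq _ _ _ _ matrix_of); split.
- move=> Gam [symG diagG _ GE [K inv K0]].
  have KE : CM (matrix_of Gam) *m \matrix_(a, b) K (cone_at a) (cone_at b) = 1%:M.
    by rewrite -CM_matrix_of; apply/(inverse_on_image cone_at_inj); rewrite -cone_image.
  have [uCM _] := mulmx1_unit KE; split=> //.
  + by apply/matrixP => i j; rewrite !mxE.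
  + by move=> i; rewrite mxE.
  + move=> k i j kE; rewrite mxE.
    have ij : adj (enum_val i) (enum_val j) by rewrite -mem_edges -kE enum_valP.
    rewrite GE ?atP ?at_adj // (@edge_function_edge _ _ _ (edge_embedding k)) //.
    by rewrite edge_embeddingE kE imsetU1 imset_set1.
  move=> i j ij nij; rewrite /theta -[invmx _]mulmx1 -KE mulmxA mulVmx // mul1mx.
  rewrite !mxE !cone_at_lshift K0 ?at_adj //.
  by rewrite (inj_eq vertex_at_inj).
- move=> Gam Gam' /set_mem[_ _ zero _ _] /set_mem[_ _ zero' _ _] /matrixP E.
  apply/funext => x; apply/funext => y.
  have [/andP[]|nS] := boolP ((x \in f @: setT) && (y \in f @: setT)); last first.
    by rewrite zero ?zero'.
  move=> /imsetP[x' _ ->] /imsetP[y' _ ->]; rewrite !at_rank.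
  by have := E (enum_rank x') (enum_rank y'); rewrite !mxE.
move=> M [symM diagM uCM ME M0].
pose Gam := extend_matrix vertex_at M.
have codomE x : (x \in codom vertex_at) = (x \in f @: setT).
  apply/codomP/imsetP => [[i ->]|[x' _ ->]]; first by exists (enum_val i).
  by exists (enum_rank x').
have MGam : matrix_of Gam = M.
  by apply/matrixP => i j; rewrite mxE /Gam extend_matrixE.
exists Gam => //; split.
- move=> x y; rewrite /Gam /extend_matrix.
  by case: pickP => [i _|_]; case: pickP => [j _|_] //; rewrite -[in LHS]symM mxE.
- by move=> x; rewrite /Gam /extend_matrix; case: pickP.
- by move=> x y; rewrite -!codomE; apply: extend_matrix0.
- move=> _ _ /imsetP[x _ ->] /imsetP[y _ ->]; rewrite f_adj => xy.
  rewrite ![in LHS]at_rank /Gam extend_matrixE //.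
  have [k kE] := adj_edge xy.
  rewrite (ME k) ?enum_rankK // (@edge_function_edge _ _ _ (edge_embedding k)) //.
  by rewrite edge_embeddingE kE imsetU1 imset_set1.
exists (extend_matrix cone_at (invmx (CM M))).
  rewrite cone_image; apply/(inverse_on_image cone_at_inj).
  rewrite CM_matrix_of MGam -[RHS](mulmxV uCM); congr (_ *m _).
  by apply/matrixP => a b; rewrite mxE extend_matrixE.
move=> _ _ /imsetP[x _ ->] /imsetP[y _ ->]; rewrite f_adj (inj_eq f_inj) => xy nxy.
rewrite !at_rank -!cone_at_lshift extend_matrixE //.
have := M0 (enum_rank x) (enum_rank y); rewrite !enum_rankK (inj_eq enum_rank_inj).
by move=> /(_ xy nxy) <-; rewrite !mxE.
Qed.

End GraphEmbedding.

(** * The Cayley-Menger block of a clique *)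

Section CliqueInverse.
Variables (R : realType) (G : sgraph) (C : {set G}).
Hypotheses (cliqueC : clique C) (C_neq0 : C != set0).

Lemma big_cone (F : fieldType) (g : option G -> F) :
  \sum_(o in cone C) g o = g None + \sum_(x in C) g (Some x).
Proof.
have -> : cone C = None |: Some @: C.
  apply/setP => -[x|]; rewrite !inE //=; by rewrite (mem_imset _ _ (@Some_inj _)).
rewrite big_setU1 /=; last by apply/imsetP => -[].
by rewrite big_imset //= => x y _ _ [].
Qed.

Lemma sum_delta (F : fieldType) (x : G) (g : G -> F) : x \in C ->
  \sum_(k in C) (x == k)%:R * g k = g x.
Proof.
move=> xC; rewrite (bigD1 x) //= eqxx mul1r big1 ?addr0 // => k /andP[_ kx].
by rewrite eq_sym (negbTE kx) mul0r.
Qed.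

(** The matrix of ones off the diagonal is the variogram of the vertices of a
    regular simplex; by symmetry the inverse of its Cayley-Menger matrix has the
    form a 1 + b J, bordered by constants. *)
Lemma all_ones_inverse : inverse_on (cone C)
  (CM_fun (fun x y => (x != y)%:R : R))
  (fun a b => match a, b with
     | Some x, Some y => 2%:R * ((x == y)%:R - #|C|%:R^-1)
     | None, None => 2%:R^-1 * (1 - #|C|%:R^-1)
     | _, _ => #|C|%:R^-1
     end).
Proof.
set q : R := #|C|%:R^-1.
have cq : #|C|%:R * q = 1 by rewrite mulfV // pnatr_eq0 cards_eq0.
have sum_const c : \sum_(k in C) c = #|C|%:R * c :> R by rewrite sumr_const mulr_natl.
have neqE (x y : G) : (x != y)%:R = 1 - (x == y)%:R :> R.
  by case: (x == y); rewrite ?subrr ?subr0.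
have sum_eq y : y \in C -> \sum_(k in C) (k == y)%:R = 1 :> R.
  move=> yC; rewrite -[RHS](sum_delta (fun=> 1) yC).
  by apply: eq_bigr => k _; rewrite mulr1 eq_sym.
move=> [x|] [y|]; rewrite !inE => // xC yC; rewrite /product_over big_cone /=.
- rewrite mul1r (eq_bigr (fun k => (x == k)%:R * ((k == y)%:R - q) - ((k == y)%:R - q))).
    rewrite sumrB sum_delta // sumrB sum_eq // sum_const cq subrr subr0.
    by rewrite addrC subrK.
  by move=> k _; rewrite neqE; field.
- rewrite mul1r (eq_bigr (fun k => (x == k)%:R * (2^-1 * q) - 2^-1 * q)).
    rewrite sumrB sum_delta // sum_const mulrBr mulr1 mulrCA cq mulr1.
    by rewrite addrA subrK subrr.
  by move=> k _; rewrite neqE; ring.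
- rewrite mul0r add0r (eq_bigr (fun k => 2 * (k == y)%:R - 2 * q)).
    by rewrite sumrB -mulr_sumr sum_eq // sum_const mulrCA cq subrr.
  by move=> k _; rewrite mul1r mulrBr.
by rewrite mul0r add0r (eq_bigr (fun=> q)) ?sum_const // => k _; rewrite mul1r.
Qed.

(** The determinant of the block is a real polynomial in the edge values, and
    it is not identically zero because it does not vanish when all of them
    are 1. *)
Lemma generically_clique_inverse :
  generically (fun w : edge_values R G => exists L, inverse_on (cone C)
    (CM_fun (fun x y => (edge_function w x y)%:C%C)) L).
Proof.
pose X (x y : G) : {mpoly R[#|edges G|]} :=
  if [pick k : 'I_#|edges G| | enum_val k == [set x; y]] is Some k then 'X_k else 0.
pose E (a b : option G) := match a, b with
  | Some x, Some y => (- 2%:R^-1)%:MP * X x y | None, None => 0 | _, _ => 1 end.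
pose P := \matrix_(i < #|cone C|, j < #|cone C|) E (enum_val i) (enum_val j).
have PE w : map_mx (meval w) P = block (cone C) (cone C) (CM_fun (edge_function w)).
  apply/matrixP => i j; rewrite !mxE.
  case: (enum_val i) => [x|]; case: (enum_val j) => [y|] /=; rewrite ?meval1 ?meval0 //.
  rewrite mevalM mevalC /X /edge_function; congr (_ * _).
  by case: pickP => [k _|_]; rewrite ?mevalXU ?meval0.
have detE w : (\det P).@[w] = \det (block (cone C) (cone C) (CM_fun (edge_function w))).
  by rewrite -PE det_map_mx.
exists (\det P); split=> [|w].
  exists (fun=> 1); rewrite detE -unitfE.
  have -> : block (cone C) (cone C) (CM_fun (edge_function (fun=> 1))) =
      block (cone C) (cone C) (CM_fun (fun x y => (x != y)%:R : R)).
    apply/block_eqP; apply: eq_CM_fun => x y xC yC.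
    have [->|xy] := eqVneq x y; first by rewrite edge_function_nonadj // adj_irrefl.
    by have [k kE] := adj_edge (cliqueC xC yC xy); rewrite (edge_function_edge _ kE).
  by have /inverse_onE/mulmx1_unit[] := all_ones_inverse.
rewrite detE -unitfE => uw; apply: inverse_on_exists.
have -> : block (cone C) (cone C) (CM_fun (fun x y => (edge_function w x y)%:C%C)) =
    map_mx (real_complex R) (block (cone C) (cone C) (CM_fun (edge_function w))).
  apply/matrixP => i j; rewrite !mxE.
  case: (enum_val i) => [x|]; case: (enum_val j) => [y|] /=; rewrite ?rmorph1 ?rmorph0 //.
  by rewrite rmorphM rmorphN fmorphV rmorph_nat.
by rewrite map_unitmx.
Qed.

End CliqueInverse.

(** * Multiplicativity *)

Section Product.
Local Open Scope card_scope.
Variables (R : realType) (G : sgraph) (A B C : {set G}).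
Hypothesis dec : clique_decomposition A B C.

Definition induced_edge (S : {set G}) :
    'I_#|edges (induced S)| -> 'I_#|edges G| :=
  edge_embedding (H := induced S) (f := val) (fun _ _ => erefl).

Lemma induced_edge_inj S : injective (@induced_edge S).
Proof. by apply: edge_embedding_inj; apply: val_inj. Qed.

Lemma completions_product :
  generically (fun w : edge_values R G => exists X Y : set (G -> G -> R[i]),
    [/\ completions w #= (X `*` Y)%classic,
        completions (w \o @induced_edge (A :|: C)) #= X
      & completions (w \o @induced_edge (B :|: C)) #= Y]).
Proof.
have [[_ _ C0] _ _ cC _] := dec.
apply: generically_sub (generically_clique_inverse R cC C0) => w [L CL].
set v := fun x y => (edge_function w x y)%:C%C in CL.
have v_diag x : v x x = 0 by rewrite /v edge_function_nonadj ?adj_irrefl.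
have F2 : (2%:R : R[i]) != 0 by rewrite pnatr_eq0.
have bij := set_bij_card_eq (solutions_product dec v_diag CL F2).
have inducedE S : completions (w \o @induced_edge S) #= solutions S v.
  have := card_completions (H := induced S) (f := val) val_inj (fun _ _ => erefl) w.
  rewrite (_ : val @: setT = S) //; apply/setP => x.
  apply/imsetP/idP => [[y _ ->]|xS]; first exact: valP.
  by exists (exist _ x xS).
have GE : completions w #= solutions setT v.
  have := card_completions (f := @id G) (@inj_id _) (fun _ _ => erefl) w.
  rewrite imset_id (_ : w \o _ = w) //; apply/funext => k /=; congr w.
  by apply: enum_val_inj; rewrite edge_embeddingE imset_id.
exists (solutions (A :|: C) v), (solutions (B :|: C) v); split; rewrite ?inducedE //.
exact: card_eq_trans GE bij.
Qed.

Lemma generic_completion_number_product k l :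
  generic_completion_number R (induced (A :|: C)) k ->
  generic_completion_number R (induced (B :|: C)) l ->
  generic_completion_number R G (k * l).
Proof.
move=> /generic_completion_numberP/(generically_pullback (@induced_edge_inj _)) gk.
move=> /generic_completion_numberP/(generically_pullback (@induced_edge_inj _)) gl.
apply/generic_completion_numberP.
apply: generically_sub (generically_and completions_product (generically_and gk gl)).
move=> w [[X [Y [GXY AX BY]]] [Ak Bl]].
apply: card_eq_trans GXY _; apply: card_eq_setX.
  exact: card_eq_trans (card_esym AX) Ak.
exact: card_eq_trans (card_esym BY) Bl.
Qed.

(** For generic w the second factor of the product is nonempty, since k is
    positive; so the first factor embeds into a set with k elements. *)
Lemma generic_completion_number_factor k : (0 < k)%N ->
  generic_completion_number R G k ->
  exists m, generic_completion_number R (induced (A :|: C)) m.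
Proof.
move=> k0 /generic_completion_numberP gk.
apply: (@bounded_generic_completion_number _ _ k.+1).
move=> /(generically_pullback (@induced_edge_inj _)) gA.
have [w [[X [Y [GXY AX _]]] [Gk Ak]]] :=
  generically_exists (generically_and completions_product (generically_and gk gA)).
have XYk := card_eq_trans (card_esym GXY) Gk.
have [g [g_inj Xg]] := at_least_card_eq AX Ak.
have [h [_ XYh]] : at_least 1 (X `*` Y)%classic.
  by apply/at_leastP; rewrite (card_le_eqr XYk) card_le_II.
suff /(at_least_leq XYk) : at_least k.+1 (X `*` Y)%classic by rewrite ltnn.
exists (fun s => (g s, (h ord0).2)); split=> [s s' [/g_inj]|s] //.
by split=> //=; have [] := XYh ord0.
Qed.

End Product.

(** When one subgraph has no generic number the right-hand side is 0, and a
    nonzero left-hand side would be a positive generic number for G. *)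
Theorem theorem4p4 (R : realType) (G : sgraph) (A B C : {set G})
    (hconn : connected_graph G) (hdec : clique_decomposition A B C) :
  eMLD R G = (eMLD R (induced (A :|: C)) * eMLD R (induced (B :|: C)))%N.
Proof.
set a := eMLD R (induced (A :|: C)); set b := eMLD R (induced (B :|: C)).
have [[[k gk] [l gl]]|none] := pselect
  ((exists k, generic_completion_number R (induced (A :|: C)) k) /\
   (exists l, generic_completion_number R (induced (B :|: C)) l)).
  rewrite /a /b (eMLD_eq gk) (eMLD_eq gl).
  exact: eMLD_eq (generic_completion_number_product hdec gk gl).
have ab0 : (a * b)%N = 0%N.
  apply/eqP; rewrite muln_eq0; apply/norP => -[/eqP/eMLD_neq0 ga /eqP/eMLD_neq0 gb].
  by apply: none; split; [exists a|exists b].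
rewrite ab0; apply/eqP/negPn/negP => /eqP G0; apply: none.
have gG := eMLD_neq0 G0.
have Gpos : (0 < eMLD R G)%N by rewrite lt0n; apply/eqP.
split; first exact: (generic_completion_number_factor hdec Gpos gG).
exact: (generic_completion_number_factor (decomposition_sym hdec) Gpos gG).
Qed.
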